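(* Let $P=K[X]$, $\sigma:P\to P$ and $S=P[s;\sigma]$ with a monomial ordering be as in the context. Let $J\subset S$ be a graded two-sided ideal and fix $d\ge0$. Assume that $J$ has an $s$-homogeneous basis $H$ such that $H_d=\{f\in H\mid\deg_s(f)\le d\}$ is a finite set. Then there exists an $s$-homogeneous Gröbner basis $G$ of $J$ such that $G_d=\{f\in G\mid \deg_s(f)\le d\}$ is also finite. In other words, with a selection strategy for the S-polynomials based on their $s$-degree, the $d$-truncated version of the algorithm SkewGBasis terminates in a finite number of steps.
   Context: $K$ is a field, $X=\{x_0,x_1,\ldots\}$ a countable set of variables, $P=K[X]$ the commutative polynomial ring, $\mathrm{Mon}(P)$ its set of monomials (including 1). $\sigma:P\to P$ is an injective $K$-algebra endomorphism of infinite order mapping monomials to monomials, with $\gcd(\sigma(x_i),\sigma(x_j))=1$ for $i\neq j$. $S=P[s;\sigma]$ is the free left $P$-module with basis $\Sigma=\{s^i\}_{i\ge0}$ and multiplication determined by $sf=\sigma(f)s$; it is graded by $S_i=Ps^i$, whose elements are called $s$-homogeneous, with $\deg_s(f)=i$ for $0\neq f\in S_i$. $\mathrm{Mon}(S)=\{ms^i\mid m\in\mathrm{Mon}(P),i\ge0\}$. $S$ is endowed with a monomial ordering $\prec$: a total well-ordering of $\mathrm{Mon}(S)$ with $v\prec w\Rightarrow pvq\prec pwq$ for all $v,w,p,q\in\mathrm{Mon}(S)$. For $f\ne0$, $\mathrm{lm}(f)$ is the largest monomial occurring in $f$, $\mathrm{lc}(f)$ its coefficient. ''Basis'' of a two-sided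 ideal means generating set; bases are taken to consist of nonzero elements. $G\subset J$ is a Gröbner basis of $J$ if $\mathrm{lm}(G)$ and $\mathrm{lm}(J)$ generate the same two-sided ideal of $S$. If $\mathrm{lm}(f)=ms^i$, $\mathrm{lm}(g)=ns^i$ and $l=\mathrm{lcm}(m,n)$, then $\mathrm{spoly}(f,g)=\frac{l}{\mathrm{lc}(f)m}f-\frac{l}{\mathrm{lc}(g)n}g$. Reduce$(f,G)$: set $h:=f$; while $h\ne0$ and there is a nonzero $g\in G$ with $\mathrm{lm}(h)=a\,\mathrm{lm}(g)$ for some $a\in\mathrm{Mon}(P)$, choose such a $g$ and replace $h$ by $h-\frac{\mathrm{lc}(h)}{\mathrm{lc}(g)}ag$; return $h$. $\Sigma G\Sigma=\{s^igs^j\mid g\in G,i,j\ge0\}$. SkewGBasis (input: an $s$-homogeneous basis $H$ of $J$): put $G:=H$, $B:=\{(f,g)\mid f,g\in G\}$. While $B\neq\emptyset$: choose and remove $(f,g)\in B$; for all $i,j\ge0$ with $i+j=\deg_s(f)-\deg_s(g)$ compute $h:=$ Reduce$(\mathrm{spoly}(f,s^igs^j),\Sigma G\Sigma)$, and for all $i,j\ge0$ with $j-i=\deg_s(f)-\deg_s(g)$ compute $h:=$ Reduce$(\mathrm{spoly}(fs^i,s^jg),\Sigma G\Sigma)$; each time $h\neq0$, put $B:=B\cup\{(h,h),(h,k),(k,h)\mid k\in G\}$ and $G:=G\cup\{h\}$. Return $G$. The $d$-truncated version starts from $H_d$ instead of $H$ and considers only S-polynomials of $s$-degree $\le d$, i.e.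 those with $\deg_s(f)\le d$ in the first loop and $\deg_s(f)+i=\deg_s(g)+j\le d$ in the second. *)

(* Defs.v *)
From HB Require Import structures.
From mathcomp Require Import all_boot all_order all_algebra.
From mathcomp Require Import finmap.
From mathcomp Require Import classical_sets cardinality.
From mathcomp Require Import monalg.

Set Implicit Arguments.
Unset Strict Implicit.
Unset Printing Implicit Defensive.

Import GRing.Theory.

Local Open Scope classical_set_scope.
Local Open Scope ring_scope.

(* The skew polynomial ring R[s; sigma]: the free left R-module {poly R}, with
   basis the powers of the variable s, and the product determined by
   (a s^i)(b s^j) = a sigma^i(b) s^(i+j).  It is a record, not an alias of
   {poly R}, so that the commutative product cannot be inferred instead. *)
Record skewpoly (R : nzRingType) (sigma : {rmorphism R -> R}) : predArgType :=
  Skew { skew_poly :> {poly R} }.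

Section SkewRing.

Variables (R : nzRingType) (sigma : {rmorphism R -> R}).

HB.instance Definition _ := [isNew for @skew_poly R sigma].
HB.instance Definition _ := [Choice of skewpoly sigma by <:].

Definition skew_mul (f g : {poly R}) : {poly R} :=
  \poly_(k < (size f + size g).-1)
    \sum_(i < k.+1) f`_i * iter i sigma g`_(k - i).

Fact iter_additive i : {morph iter i sigma : x y / x + y}.
Proof. by elim: i => //= i IH x y; rewrite /= IH rmorphD. Qed.

Fact iter_multiplicative i : {morph iter i sigma : x y / x * y}.
Proof. by elim: i => //= i IH x y; rewrite /= IH rmorphM. Qed.

Fact iter_sigma0 i : iter i sigma 0 = 0.
Proof. by elim: i => //= i ->; rewrite rmorph0. Qed.

Fact iter_sigma1 i : iter i sigma 1 = 1.
Proof. by elim: i => //= i ->; rewrite rmorph1. Qed.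

Fact iter_sigma_sum i n (F : 'I_n -> R) :
  iter i sigma (\sum_j F j) = \sum_j iter i sigma (F j).
Proof. by apply: big_morph; [exact: iter_additive | exact: iter_sigma0]. Qed.

Fact coef_skew_mul f g k :
  (skew_mul f g)`_k = \sum_(i < k.+1) f`_i * iter i sigma g`_(k - i).
Proof.
rewrite coef_poly ltn_predRL; case: leqP => // le_fg_k1.
rewrite big1 // => j _; have [lg_f_j|lt_j_f] := leqP (size f) j.
  by rewrite nth_default ?mul0r.
rewrite [g`__]nth_default ?iter_sigma0 ?mulr0 // leq_subRL -ltnS //.
by rewrite (leq_trans _ le_fg_k1) // ltn_add2r.
Qed.

Fact coef_skew_mul_rev f g k :
  (skew_mul f g)`_k = \sum_(i < k.+1) f`_(k - i) * iter (k - i) sigma g`_i.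
Proof.
rewrite coef_skew_mul (reindex_inj rev_ord_inj) /=.
by apply: eq_bigr => j _; rewrite (sub_ordK j).
Qed.

Fact skew_mulA : associative skew_mul.
Proof.
move=> f g h; apply/polyP=> i; rewrite coef_skew_mul coef_skew_mul_rev.
pose c3 j k :=
  f`_j * (iter j sigma g`_(i - j - k) * iter (i - k) sigma h`_k).
transitivity (\sum_(j < i.+1) \sum_(k < i.+1 | (k <= i - j)%N) c3 j k).
  apply: eq_bigr => /= j _.
  rewrite coef_skew_mul_rev iter_sigma_sum big_distrr /=.
  rewrite (big_ord_narrow_leq (leq_subr _ _)); apply: eq_bigr => k _ /=.
  rewrite iter_multiplicative -iterD /c3; congr (_ * (_ * iter _ sigma _)).
  have le_j_i : (j <= i)%N by rewrite -ltnS.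
  by rewrite addnBA ?subnKC // -ltnS.
rewrite (exchange_big_dep predT) //=; apply: eq_bigr => k _.
transitivity (\sum_(j < i.+1 | (j <= i - k)%N) c3 j k).
  apply: eq_bigl => j; rewrite -ltnS -(ltnS j) -!subSn ?leq_ord //.
  by rewrite -subn_gt0 -(subn_gt0 j) -!subnDA addnC.
rewrite (big_ord_narrow_leq (leq_subr _ _)) coef_skew_mul big_distrl /=.
by apply: eq_bigr => j _; rewrite /c3 -!subnDA addnC mulrA.
Qed.

Fact skew_mul1f : left_id 1%:P skew_mul.
Proof.
move=> f; apply/polyP => i; rewrite coef_skew_mul big_ord_recl subn0 /=.
by rewrite big1 => [|j _]; rewrite coefC /= ?mul1r ?mul0r ?addr0.
Qed.

Fact skew_mulf1 : right_id 1%:P skew_mul.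
Proof.
move=> f; apply/polyP => i; rewrite coef_skew_mul_rev big_ord_recl subn0 /=.
rewrite big1 => [|j _]; rewrite coefC /= ?iter_sigma1 ?mulr1 ?addr0 //.
by rewrite iter_sigma0 mulr0.
Qed.

Fact skew_mulDl : left_distributive skew_mul +%R.
Proof.
move=> f g h; apply/polyP=> i; rewrite coefD !coef_skew_mul -big_split.
by apply: eq_bigr => j _; rewrite coefD mulrDl.
Qed.

Fact skew_mulDr : right_distributive skew_mul +%R.
Proof.
move=> f g h; apply/polyP=> i; rewrite coefD !coef_skew_mul -big_split.
by apply: eq_bigr => j _; rewrite coefD iter_additive mulrDr.
Qed.

Implicit Types (a b : R) (f g h : skewpoly sigma).

Let skew0 : skewpoly sigma := Skew sigma 0.
Let skew1 : skewpoly sigma := Skew sigma 1.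
Let skew_opp f : skewpoly sigma := Skew sigma (- (f : {poly R})).
Let skew_add f g : skewpoly sigma := Skew sigma ((f : {poly R}) + g).
Let skew_scale a f : skewpoly sigma := Skew sigma (a *: (f : {poly R})).
Let skew_prod f g : skewpoly sigma := Skew sigma (skew_mul f g).

Fact skew_addA : associative skew_add.
Proof. by move=> f g h; apply/val_inj/addrA. Qed.

Fact skew_addC : commutative skew_add.
Proof. by move=> f g; apply/val_inj/addrC. Qed.

Fact skew_add0 : left_id skew0 skew_add.
Proof. by move=> f; apply/val_inj/add0r. Qed.

Fact skew_addN : left_inverse skew0 skew_opp skew_add.
Proof. by move=> f; apply/val_inj/addNr. Qed.

HB.instance Definition _ := GRing.isZmodule.Build (skewpoly sigma)
  skew_addA skew_addC skew_add0 skew_addN.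

Fact skew_scaleA a b f :
  skew_scale a (skew_scale b f) = skew_scale (a * b) f.
Proof. exact/val_inj/scalerA. Qed.

Fact skew_scale1 : left_id 1 skew_scale.
Proof. by move=> f; apply/val_inj/scale1r. Qed.

Fact skew_scaleDr : right_distributive skew_scale +%R.
Proof. by move=> a f g; apply/val_inj/scalerDr. Qed.

Fact skew_scaleDl f : {morph skew_scale^~ f : a b / a + b}.
Proof. by move=> a b; apply/val_inj/scalerDl. Qed.

HB.instance Definition _ := GRing.Zmodule_isLmodule.Build R (skewpoly sigma)
  skew_scaleA skew_scale1 skew_scaleDr skew_scaleDl.

Fact skew_prodA : associative skew_prod.
Proof. by move=> f g h; apply/val_inj/skew_mulA. Qed.

Fact skew_prod1f : left_id skew1 skew_prod.
Proof. by move=> f; apply/val_inj/skew_mul1f. Qed.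

Fact skew_prodf1 : right_id skew1 skew_prod.
Proof. by move=> f; apply/val_inj/skew_mulf1. Qed.

Fact skew_prodDl : left_distributive skew_prod +%R.
Proof. by move=> f g h; apply/val_inj/skew_mulDl. Qed.

Fact skew_prodDr : right_distributive skew_prod +%R.
Proof. by move=> f g h; apply/val_inj/skew_mulDr. Qed.

Fact skew_oner_neq0 : skew1 != 0.
Proof. by rewrite -val_eqE /= oner_neq0. Qed.

HB.instance Definition _ := GRing.Zmodule_isNzRing.Build (skewpoly sigma)
  skew_prodA skew_prod1f skew_prodf1 skew_prodDl skew_prodDr skew_oner_neq0.

Lemma coef_skewM f g k :
  (f * g)`_k = \sum_(i < k.+1) f`_i * iter i sigma g`_(k - i).
Proof. exact: coef_skew_mul. Qed.

Lemma coef_skewZ a f k : (a *: f)`_k = a * f`_k.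
Proof. exact: coefZ. Qed.

Fact skew_scaleAl a f g : a *: (f * g) = (a *: f) * g.
Proof.
apply/val_inj/polyP=> k; rewrite coef_skewZ !coef_skewM big_distrr /=.
by apply: eq_bigr => i _; rewrite coefZ mulrA.
Qed.

HB.instance Definition _ :=
  GRing.Lmodule_isLalgebra.Build R (skewpoly sigma) skew_scaleAl.

Definition skew_s : skewpoly sigma := Skew sigma 'X.

Lemma skew_sC a : skew_s * a%:A = sigma a *: skew_s.
Proof.
apply/val_inj/polyP=> k; rewrite coef_skewM coef_skewZ coefX.
case: k => [|k]; first by rewrite big_ord1 coefX mul0r mulr0.
rewrite big_ord_recl coefX mul0r add0r big_ord_recl coefX mul1r.
rewrite big1 => [|j _]; last by rewrite coefX mul0r.
rewrite addr0 /bump /= subSS subn0 coefZ coef1.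
by case: k => [|k]; rewrite /= ?mulr1 // !mulr0 rmorph0.
Qed.

Lemma skew_sX i : skew_s ^+ i = Skew sigma 'X^i.
Proof.
elim: i => [|i IH]; first by rewrite !expr0.
apply/val_inj/polyP=> k; rewrite exprS IH coef_skewM coefXn.
case: k => [|k]; first by rewrite big_ord1 coefX mul0r.
rewrite big_ord_recl coefX mul0r add0r big_ord_recl coefX mul1r.
rewrite big1 => [|j _]; last by rewrite coefX mul0r.
rewrite addr0 /bump /= subSS subn0 coefXn eqSS.
by case: eqP => _; rewrite ?rmorph1 ?rmorph0.
Qed.

End SkewRing.

Notation Pmon := {cmonom nat}.
Notation Ppoly K := {malg K[{cmonom nat}]}.

Definition x_ (K : fieldType) (i : nat) : Ppoly K := << ucm i >>.

Definition mlcm (m n : Pmon) : Pmon :=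
  [cmonom maxn (m k) (n k) | k in (finsupp m `|` finsupp n)%fset]%M.

Definition infinite_order (T : Type) (sigma : T -> T) :=
  forall i j : nat, iter i sigma =1 iter j sigma -> i = j.

Definition monomial_preserving (K : fieldType) (sigma : Ppoly K -> Ppoly K) :=
  forall m : Pmon, exists n : Pmon, sigma << m >> = << n >>.

(* gcd(p, q) = 1: the common divisors of p and q are units. *)
Definition gcd_one (R : comNzRingType) (p q : R) :=
  forall e : R, (exists a, p = a * e) -> (exists b, q = b * e) ->
    exists c, c * e = 1.

Section SkewGrobner.

Variables (K : fieldType) (sigma : {lrmorphism Ppoly K -> Ppoly K}).

Notation S := (skewpoly sigma).
Notation s := (skew_s sigma).

(* The pair (m, i) stands for the monomial m s^i. *)
Definition Smon : Type := (Pmon * nat)%type.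

Definition mon (v : Smon) : S := << v.1 >> *: s ^+ v.2.

Definition monos (f : S) : seq Smon :=
  [seq (m, i) | i <- iota 0 (size f), m <- msupp f`_i].

(* The last condition reads p v q < p w q: Mon(S) is closed under the product
   of S, and v', w' are the indices of the monomials p v q, p w q. *)
Record monomial_order (prec : rel Smon) : Prop := MonomialOrder {
  prec_irr : irreflexive prec;
  prec_trans : transitive prec;
  prec_total : forall v w, v != w -> prec v w || prec w v;
  prec_wf : well_founded prec;
  prec_mul : forall p q v w v' w' : Smon, prec v w ->
    mon v' = mon p * mon v * mon q -> mon w' = mon p * mon w * mon q ->
    prec v' w' }.

Definition two_sided_ideal (I : set S) :=
  [/\ I 0, forall f g, I f -> I g -> I (f + g) &
      forall a f b, I f -> I (a * f * b)].

Definition ideal_gen (A : set S) : set S :=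
  \bigcap_(I in [set I | two_sided_ideal I /\ A `<=` I]) I.

Definition graded (J : set S) := forall f, J f -> forall i, J (f`_i *: s ^+ i).

Definition homogeneous (f : S) := exists i p, f = p *: s ^+ i.

(* The s-degree of a nonzero s-homogeneous element. *)
Definition sdeg (f : S) : nat := (size f).-1.

Definition trunc (d : nat) (A : set S) : set S :=
  [set f | A f /\ (sdeg f <= d)%N].

Definition nz_homogeneous (A : set S) :=
  forall f, A f -> f <> 0 /\ homogeneous f.

Definition homogeneous_basis (J H : set S) :=
  nz_homogeneous H /\ ideal_gen H = J.

Section Order.

Variable prec : rel Smon.

(* For f <> 0, the prec-largest monomial occurring in f. *)
Definition lm (f : S) : Smon :=
  foldr (fun v w => if prec w v then v else w) (head (mone, 0%N) (monos f))
    (monos f).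

Definition lc (f : S) : K := (f`_(lm f).2)@_((lm f).1).

Definition lm_set (A : set S) : set S := [set mon (lm f) | f in A `\ 0].

Definition grobner_basis (J G : set S) :=
  G `<=` J /\ ideal_gen (lm_set G) = ideal_gen (lm_set J).

Definition spoly (f g : S) : S :=
  let l := mlcm (lm f).1 (lm g).1 in
  << (lc f)^-1 *g divcm l (lm f).1 >> *: f
  - << (lc g)^-1 *g divcm l (lm g).1 >> *: g.

Definition shifts (G : set S) : set S :=
  [set h | exists2 g, G g & exists i j, h = s ^+ i * g * s ^+ j].

(* One iteration of the loop of Reduce(-, G). *)
Definition reduce1 (G : set S) (h h' : S) :=
  h <> 0 /\ exists g (a : Pmon),
    [/\ G g, g <> 0, mon (lm h) = mon (a, 0%N) * mon (lm g) &
        h' = h - << lc h / lc g *g a >> *: g].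

(* The pairs of elements of S whose S-polynomials the d-truncated algorithm
   computes for the pair (f, g): the two loops, respectively. *)
Definition spairs (d : nat) (f g : S) : set (S * S) :=
  [set (f, s ^+ ij.1 * g * s ^+ ij.2) | ij in
     [set ij : nat * nat |
       (ij.1 + ij.2 + sdeg g = sdeg f)%N /\ (sdeg f <= d)%N]] `|`
  [set (f * s ^+ ij.1, s ^+ ij.2 * g) | ij in
     [set ij : nat * nat |
       (sdeg f + ij.1 = sdeg g + ij.2)%N /\ (sdeg f + ij.1 <= d)%N]].

(* The current set G, the pairs (u, v) whose S-polynomial is still to be
   treated, and the polynomial h under reduction, if any. *)
Record state := State {
  st_basis : set S;
  st_pairs : set (S * S);
  st_current : option S }.

(* The elementary steps of the d-truncated SkewGBasis, with the selection
   strategy that always takes a pending S-polynomial of least s-degree; all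
   other choices are left open. *)
Inductive step (d : nat) : state -> state -> Prop :=
| step_select G B u v :
    B (u, v) -> (forall q, B q -> (sdeg u <= sdeg q.1)%N) ->
    step d (State G B None) (State G (B `\ (u, v)) (Some (spoly u v)))
| step_reduce G B h h' :
    reduce1 (shifts G) h h' ->
    step d (State G B (Some h)) (State G B (Some h'))
| step_discard G B :
    step d (State G B (Some 0)) (State G B None)
| step_insert G B h :
    h <> 0 -> ~ (exists h', reduce1 (shifts G) h h') ->
    step d (State G B (Some h))
      (State (h |` G)
         (B `|` spairs d h h `|` \bigcup_(k in G) (spairs d h k `|` spairs d k h))
         None).

Definition initial (d : nat) (H : set S) : state :=
  State (trunc d H)
    (\bigcup_(f in trunc d H) \bigcup_(g in trunc d H) spairs d f g) None.

Definition truncated_SkewGBasis_terminates (d : nat) (H : set S) :=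
  Acc (fun st' st => step d st st') (initial d H).

End Order.

End SkewGrobner.

(* Main.v *)
(** Right multiplication by P acts on P s^e through sigma^e, so for e <= d the
    component J_e is the left P-module generated by the s^i f s^j with f in the
    finite set H_d. These generators, hence all the polynomials that the
    algorithm handles in degree e, have their coefficients in a polynomial ring
    K[W_e] with W_e finite, where W_(e+1) is W_e together with the variables of
    sigma(x), x in W_e. Leading monomials of J_e are multiples of leading
    monomials of elements with coefficients in K[W_e], so Dickson's lemma in
    finitely many variables gives the first claim; in degrees > d all homogeneous
    elements of J may be put in G. An inserted polynomial has a leading monomial
    that no earlier one of the same s-degree divides, so Dickson's lemma also
    bounds the number of insertions, whatever the selection strategy. *)

Require Import Defs.
From HB Require Import structures.
From mathcomp Require Import all_boot all_order all_algebra.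
From mathcomp Require Import finmap.
From mathcomp Require Import boolp classical_sets cardinality.
From mathcomp Require Import monalg.

Set Implicit Arguments.
Unset Strict Implicit.
Unset Printing Implicit Defensive.

Import GRing.Theory.

Local Open Scope classical_set_scope.
Local Open Scope ring_scope.

(** * Dickson's lemma *)

Lemma not_Acc_step (T : Type) (R : T -> T -> Prop) x :
  ~ Acc R x -> exists y, R y x /\ ~ Acc R y.
Proof.
move=> nx; apply: contrapT => no; apply: nx; constructor => y Ryx.
by apply: contrapT => ny; apply: no; exists y.
Qed.

Lemma wf_no_infinite_descent (T : Type) (R : T -> T -> Prop) :
  (forall f : nat -> T, ~ (forall n, R (f n.+1) (f n))) -> well_founded R.
Proof.
move=> noR x; apply: contrapT => nx.
pose nacc := {y | ~ Acc R y}.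
have next (y : nacc) : {z : nacc | R (sval z) (sval y)}.
  apply: cid; case: y => y ny /=.
  by have [z [Rzy nz]] := not_Acc_step ny; exists (exist _ z nz).
pose f n := iter n (fun y => sval (next y)) (exist _ x nx).
by apply: (noR (fun n => sval (f n))) => n; exact: svalP (next (f n)).
Qed.

(** * Well quasi-orders and induction on bad sequences *)

Section WellQuasiOrder.
Local Open Scope nat_scope.

Lemma nat_seq_mono_subseq (u : nat -> nat) :
  exists phi : nat -> nat,
    {homo phi : i j / i < j} /\ {homo u \o phi : i j / i <= j}.
Proof.
have argmin n : exists m, n <= m /\ forall k, n <= k -> u m <= u k.
  have ex : exists v, `[< exists2 m, n <= m & u m = v >].
    by exists (u n); apply/asboolP; exists n.
  case: (ex_minnP ex) => v /asboolP[m le_nm um] minv.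
  exists m; split=> // k le_nk; rewrite um; apply: minv.
  by apply/asboolP; exists k.
have [next nextP] := choice argmin.
(* Each chosen index minimises [u] over everything after the previous choice, hence the values along
   [phi] cannot decrease. *)
pose phi := fix phi n := if n is n'.+1 then next (phi n').+1 else next 0.
have phiP n : exists m, m <= phi n /\ forall k, m <= k -> u (phi n) <= u k.
  by case: n => [|n] /=; [exists 0 | exists (phi n).+1]; exact: nextP.
have phi_lt n : phi n < phi n.+1 by have [] := nextP (phi n).+1.
exists phi; split; first exact: (homo_ltn ltn_trans).
apply: (homo_leq leqnn leq_trans) => n /=.
by have [m [le_m]] := phiP n; apply; exact/(leq_trans le_m)/ltnW.
Qed.

(** A monotone subsequence stays monotone when thinned out further, so the sequences are treated one
    after the other. *)
Lemma nat_seqs_mono_subseq (us : seq (nat -> nat)) :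
  exists phi : nat -> nat, {homo phi : i j / i < j} /\
    forall i j, i <= j -> all (fun u => u (phi i) <= u (phi j)) us.
Proof.
elim: us => [|u us [phi [phi_lt phiP]]]; first by exists id; split.
have [psi [psi_lt psiP]] := nat_seq_mono_subseq (u \o phi).
exists (phi \o psi); split=> [i j ij|i j ij] /=.
  by apply: phi_lt; apply: psi_lt.
apply/andP; split; first exact: psiP.
apply: phiP.
by move: ij; rewrite leq_eqVlt => /predU1P[->//|/psi_lt/ltnW].
Qed.

(* [le] is a well quasi-order on [dom], except that no property of a preorder is
   asked for. *)
Definition wqo_on (T : Type) (dom : T -> Prop) (le : T -> T -> Prop) :=
  forall u : nat -> T, (forall n, dom (u n)) ->
    exists i j, i < j /\ le (u i) (u j).

(** One step of growing a bad sequence, latest element first. Its well-foundedness turns the well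
    quasi-order property into an induction principle. *)
Inductive bad_extension (T : eqType) (dom : T -> Prop) (le : T -> T -> Prop)
  (l : seq T) : seq T -> Prop :=
| BadExtension v : dom v -> (forall w, w \in l -> ~ le w v) ->
    bad_extension dom le l (v :: l).

(** In an infinite chain of extensions the successive new heads form a sequence [u]. A pair i < j
    with [u i] below [u j] is impossible, because [u i] is still in the list when [u j] is added. *)
Lemma wqo_bad_extension_wf (T : eqType) (dom : T -> Prop) (le : T -> T -> Prop) :
  wqo_on dom le -> well_founded (fun l' l => bad_extension dom le l l').
Proof.
move=> wqo; apply: wf_no_infinite_descent => f fP.
have /choice[u uP] n : exists v, [/\ dom v, f n.+1 = v :: f n &
    forall w, w \in (f n) -> ~ le w v].
  by case: (fP n) => v; exists v.
have [i [j [lt_ij]]] : exists i j, i < j /\ le (u i) (u j).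
  by apply: wqo => n; case: (uP n).
have in_f k : (u i) \in (f (i + k).+1).
  elim: k => [|k IH].
    by rewrite addn0; case: (uP i) => _ -> _; exact: mem_head.
  by rewrite addnS; case: (uP (i + k).+1) => _ -> _; rewrite in_cons IH orbT.
have [_ _] := uP j; apply.
by have := in_f (j - i.+1); rewrite -addSn subnKC.
Qed.

(** A list that is not yet a basis extends by an element of [A] whose image is above no earlier
    image, and such extensions must stop. *)
Lemma wqo_finite_basis (T E : eqType) (dom : T -> Prop) (le : T -> T -> Prop)
    (f : E -> T) (A : E -> Prop) :
  wqo_on dom le -> (forall x, A x -> dom (f x)) ->
  exists l : seq E, (forall x, x \in l -> A x) /\
    forall x, A x -> exists2 y, y \in l & le (f y) (f x).
Proof.
move=> /wqo_bad_extension_wf wf Adom.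
suff ext fl l : fl = map f l -> (forall x, x \in l -> A x) ->
    exists l : seq E, (forall x, x \in l -> A x) /\
      forall x, A x -> exists2 y, y \in l & le (f y) (f x).
  exact: (ext [::] [::]).
elim: {fl}(wf fl) l => fl _ IH l def_fl lA.
have [basis|] := pselect (forall x, A x -> exists2 y, y \in l & le (f y) (f x)).
  by exists l.
move=> /existsNP[x /not_implyP[Ax nx]].
apply: (IH (f x :: fl) _ (x :: l)).
- constructor; first exact: Adom.
  by rewrite def_fl => _ /mapP[y yl ->] le_yx; apply: nx; exists y.
- by rewrite def_fl.
- by move=> y /[!in_cons] /predU1P[->|/lA].
Qed.

End WellQuasiOrder.

Definition mon_in (W : {fset nat}) (m : Pmon) := forall k, k \notin W -> m k = 0%N.

(** Divisibility by a left factor in Mon(P), as in Reduce; such a factor leaves the power of s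
    unchanged. *)
Definition smon_dvd (v w : Smon) := (forall k, (v.1 k <= w.1 k)%N) /\ v.2 = w.2.

Lemma dickson (W : {fset nat}) d :
  wqo_on (fun v : Smon => mon_in W v.1 /\ (v.2 <= d)%N) smon_dvd.
Proof.
move=> u uP.
(* Monotonicity of both the s-exponent and its complement to d forces equal s-exponents; the bound
   by d makes the truncated subtraction faithful. *)
pose us := [:: fun n => (u n).2, fun n => (d - (u n).2)%N &
  [seq (fun n => (u n).1 k) | k <- W]].
have [phi [phi_lt phiP]] := nat_seqs_mono_subseq us.
exists (phi 0%N), (phi 1%N); split; first exact: phi_lt.
have /and3P[le01 ge01 /allP/= allW] := phiP 0%N 1%N isT; split=> [k|].
  have [kW|kW] := boolP (k \in W); last by rewrite (uP _).1.
  by apply: (allW (fun n => (u n).1 k)); apply: map_f.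
by apply/eqP; rewrite eqn_leq le01 -(@leq_sub2lE d) // (uP _).2.
Qed.

Lemma cmonomP (m n : Pmon) : (forall k, m k = n k) -> m = n.
Proof. by move=> eq_mn; apply/eqP/cmP. Qed.

Lemma mmul_inj (k : Pmon) : injective (mmul k).
Proof.
move=> m n eq_mn; apply: cmonomP => i; apply: (@addnI (k i)).
by rewrite -!cmM eq_mn.
Qed.

Lemma divcmK (m n : Pmon) : (forall k, (m k <= n k)%N) -> mmul (divcm n m) m = n.
Proof. by move=> le_mn; apply: cmonomP => k; rewrite cmM divcmE subnK. Qed.

Lemma smon_dvdP (v w : Smon) :
  smon_dvd v w <-> exists a : Pmon, w = (mmul a v.1, v.2).
Proof.
case: v w => [m i] [n j]; split=> [[/= le_mn ->]|[a [-> ->]]].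
  by exists (divcm n m); rewrite divcmK.
by split=> //= k; rewrite cmM leq_addl.
Qed.

(** * Polynomials in finitely many variables *)

Section MonIn.
Variable W : {fset nat}.

Lemma mon_in1 : mon_in W mone.
Proof. by move=> k _; rewrite cm1. Qed.

Lemma mon_inM (m n : Pmon) : mon_in W (mmul m n) <-> mon_in W m /\ mon_in W n.
Proof.
split=> [mnW|[mW nW] k kW]; last by rewrite cmM mW ?nW.
split=> k /mnW; rewrite cmM => /eqP; rewrite addn_eq0 => /andP[] /eqP + /eqP //.
Qed.

Lemma mon_in_divcm (m n : Pmon) : mon_in W m -> mon_in W (divcm m n).
Proof. by move=> mW k kW; rewrite divcmE mW. Qed.

Lemma mlcmE (m n : Pmon) k : mlcm m n k = maxn (m k) (n k).
Proof.
rewrite /mlcm cmE /= fsfun_fun in_fsetU -!cmE_neq0.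
by case: (m k) (n k) => [|a] [|b].
Qed.

Lemma mon_in_mlcm (m n : Pmon) : mon_in W m -> mon_in W n -> mon_in W (mlcm m n).
Proof. by move=> mW nW k kW; rewrite mlcmE mW ?nW. Qed.

Lemma mon_split (m : Pmon) : exists n n', [/\ m = mmul n n', mon_in W n' &
  forall k, k \in W -> n k = 0%N].
Proof.
pose n' : Pmon := [cmonom m k | k in W]%M.
have n'E k : n' k = if k \in W then m k else 0%N by rewrite cmE /= fsfun_fun.
exists (divcm m n'), n'; split=> [|k|k kW].
- by rewrite divcmK // => k; rewrite n'E; case: ifP.
- by rewrite n'E => /negbTE->.
- by rewrite divcmE n'E kW subnn.
Qed.

Variable K : fieldType.
Implicit Types p q : Ppoly K.

(** Membership in the subring K[W] of K[X]. *)
Definition poly_in p := forall m, m \in msupp p -> mon_in W m.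

Lemma poly_in0 : poly_in 0.
Proof. by move=> m; rewrite msupp0. Qed.

Lemma poly_inU c (m : Pmon) : mon_in W m -> poly_in << c *g m >>.
Proof. by move=> mW n /(fsubsetP msuppU_le) /fset1P ->. Qed.

Lemma poly_inD p q : poly_in p -> poly_in q -> poly_in (p + q).
Proof.
by move=> pW qW m /(fsubsetP (msuppD_le _ _)) /fsetUP[/pW|/qW].
Qed.

Lemma poly_inN p : poly_in p -> poly_in (- p).
Proof. by move=> pW m; rewrite msuppN => /pW. Qed.

Lemma poly_inM p q : poly_in p -> poly_in q -> poly_in (p * q).
Proof.
move=> pW qW m /msuppM_le[m1 [m2 [/pW ? /qW ? ->]]]; exact/mon_inM.
Qed.

Lemma poly_in_sum (I : Type) (r : seq I) (P : pred I) (F : I -> Ppoly K) :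
  (forall i, P i -> poly_in (F i)) -> poly_in (\sum_(i <- r | P i) F i).
Proof. exact: (big_ind _ poly_in0 poly_inD). Qed.

End MonIn.

Lemma mon_inW (W V : {fset nat}) m : (W `<=` V)%fset -> mon_in W m -> mon_in V m.
Proof. by move=> /fsubsetP WV mW k kV; apply: mW; apply: contra kV => /WV. Qed.

Lemma poly_inW (K : fieldType) (W V : {fset nat}) (p : Ppoly K) :
  (W `<=` V)%fset -> poly_in W p -> poly_in V p.
Proof. by move=> WV pW m /pW /(mon_inW WV). Qed.

Definition pvars (K : fieldType) (p : Ppoly K) : {fset nat} :=
  (\bigcup_(m <- msupp p) finsupp (m : Pmon))%fset.

Lemma poly_in_pvars (K : fieldType) (p : Ppoly K) : poly_in (pvars p) p.
Proof.
move=> m mp k kp; apply/eqP; rewrite cmE_eq0.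
by apply: contra kp => km; apply/bigfcupP; exists m; rewrite // mp.
Qed.

Lemma malgMUU (K : fieldType) (c c' : K) (m m' : Pmon) :
  << c *g m >> * << c' *g m' >> = << c * c' *g mmul m m' >>.
Proof. exact: fgmulUU. Qed.

Lemma malgU_inj (K : fieldType) : injective (fun m : Pmon => << m >> : Ppoly K).
Proof.
move=> m n eq_mn.
have Usupp (k : Pmon) : msupp (<< k >> : Ppoly K) = [fset k]%fset.
  by rewrite msuppU oner_eq0.
have := etrans (esym (Usupp m)) (etrans (congr1 msupp eq_mn) (Usupp n)).
by move/fset1_inj.
Qed.

Lemma mcoeff_mulU (K : fieldType) c (k n : Pmon) (p : Ppoly K) :
  (<< c *g k >> * p)@_(mmul k n) = c * p@_n.
Proof.
rewrite (mcoeffMlw _ msuppU_le (fsubset_refl _)) big_seq_fset1 mcoeffUU.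
rewrite (eq_bigr (fun k' => << c * p@_k' *g k' >>@_n)) => [|k' _]; last first.
  by rewrite mcoeffU (inj_eq (@mmul_inj k)).
by rewrite -raddf_sum -mcoeffZ malgZ_def.
Qed.

Lemma mcoeff_mulUM (K : fieldType) c (k m n : Pmon) (p : Ppoly K) :
  (<< c *g mmul m k >> * p)@_(mmul m n) = (<< c *g k >> * p)@_n.
Proof.
have -> : << c *g mmul m k >> = << 1 *g m >> * << c *g k >>.
  by rewrite malgMUU mul1r.
by rewrite -[_ * _ * _]mulrA mcoeff_mulU mul1r.
Qed.

(** * Variables created by sigma *)

Section SigmaVars.
Variables (K : fieldType) (sigma : {lrmorphism Ppoly K -> Ppoly K}).

Definition sigma_vars (W : {fset nat}) : {fset nat} :=
  (W `|` \bigcup_(k <- W) pvars (sigma (x_ K k)))%fset.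

(** By K-linearity it suffices to treat monomials, which is done by induction on the total degree,
    splitting off one variable of W at a time. *)
Lemma poly_in_sigma W p : poly_in W p -> poly_in (sigma_vars W) (sigma p).
Proof.
have sigma_mon m : mon_in W m -> poly_in (sigma_vars W) (sigma << m >>).
  have [n] := ubnP (mdeg m); elim: n m => // n IH m lt_m_n mW.
  have [->|] := eqVneq m mone.
    by rewrite (_ : << mone >> = 1) // rmorph1; apply/poly_inU/mon_in1.
  rewrite -mdeg_eq0 mdegE sum_nat_seq_neq0 => /hasP[k km /= mk].
  have def_m : m = mmul (ucm k) (divcm m (ucm k)).
    rewrite mulmC divcmK // => i; rewrite cmU; case: eqP => // <-.
    by rewrite lt0n.
  rewrite {1}def_m -[X in << X *g _ >>]mulr1 -malgMUU rmorphM.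
  apply: poly_inM; last first.
    apply: IH; last exact: mon_in_divcm.
    by move: lt_m_n; rewrite {1}def_m mdegM mdegU.
  have kW : k \in W by apply: contraTT mk => /mW ->.
  apply: poly_inW (@poly_in_pvars _ _); apply: fsubsetU; apply/orP; right.
  exact: bigfcup_sup.
have sigmaZ c q : sigma (c *: q) = c *: sigma q by rewrite linearZ_LR.
have eqU m : << p@_m *g m >> = p@_m *: << m >>.
  by rewrite -mul_malgC malgMUU mulr1 mul1m.
have -> : sigma p = \sum_(m <- msupp p) p@_m *: sigma << m >>.
  rewrite {1}[p]monalgE rmorph_sum; apply: eq_bigr => m _.
  by rewrite -sigmaZ -eqU.
move=> pW; rewrite big_seq; apply: poly_in_sum => m mp.
rewrite -mul_malgC; apply: poly_inM (sigma_mon m _); last exact: pW.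
exact/poly_inU/mon_in1.
Qed.

End SigmaVars.

(** * Leading monomials in the skew polynomial ring *)

Section SkewMonomials.
Variables (K : fieldType) (sigma : {lrmorphism Ppoly K -> Ppoly K}).

Notation S := (skewpoly sigma).
Notation s := (skew_s sigma).

Implicit Types (f g h : S) (p q : Ppoly K) (v w : Smon).

Lemma skewP f g : (forall k, f`_k = g`_k) -> f = g.
Proof. by move=> eq_fg; apply/val_inj/polyP. Qed.

Lemma coef_skew0 k : (0 : S)`_k = 0.
Proof. exact: coef0. Qed.

Lemma coef_skewD f g k : (f + g)`_k = f`_k + g`_k.
Proof. exact: coefD. Qed.

Lemma coef_skewN f k : (- f)`_k = - f`_k.
Proof. exact: coefN. Qed.

Lemma coef_skewZX p i k : (p *: s ^+ i)`_k = if k == i then p else 0.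
Proof.
by rewrite coef_skewZ skew_sX coefXn; case: eqP; rewrite ?mulr1 ?mulr0.
Qed.

Lemma skew_shift i p j k :
  s ^+ i * (p *: s ^+ j) * s ^+ k = iter i sigma p *: s ^+ (i + j + k).
Proof.
have -> : s ^+ i * (p *: s ^+ j) = iter i sigma p *: s ^+ (i + j).
  elim: i => [|i IH]; first by rewrite mul1r.
  rewrite exprS -mulrA IH -[s ^+ (i + j)]mul1r scalerAl mulrA skew_sC /=.
  by rewrite -scalerAl -exprS.
by rewrite -scalerAl -exprD.
Qed.

Lemma mem_monos f v : (v \in monos f) = ((f`_v.2)@_v.1 != 0).
Proof.
case: v => m i; rewrite /= mcoeff_neq0.
apply/allpairsPdep/idP => [[j [n [_ nf [-> ->]]]] //|mf].
exists i, m; split=> //; rewrite mem_iota /= add0n ltnNge.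
by apply: contraTN mf => le_f_i; rewrite nth_default // msupp0.
Qed.

Lemma monos_eq0 f : (forall v, v \notin monos f) -> f = 0.
Proof.
move=> f0; apply: skewP => i; apply/malgP => m; apply/eqP.
by have := f0 (m, i); rewrite mem_monos negbK coef_skew0 mcoeff0.
Qed.

Lemma coef_mon v k : (mon sigma v)`_k = if k == v.2 then << v.1 >> else 0.
Proof. exact: coef_skewZX. Qed.

Lemma mon_inj : injective (mon sigma).
Proof.
case=> [m i] [n j] eq_mn; have := coef_mon (m, i) i; rewrite eq_mn coef_mon eqxx.
have U0 (k : Pmon) : << k >> <> 0 :> Ppoly K.
  by apply/eqP; rewrite monalgU_eq0 oner_eq0.
by case: eqP => [/= -> /malgU_inj->|_ /esym/U0].
Qed.

Lemma monM (a : Pmon) v :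
  mon sigma (a, 0%N) * mon sigma v = mon sigma (mmul a v.1, v.2).
Proof.
have scaleM p q i : (p *: s ^+ 0) * (q *: s ^+ i) = (p * q) *: s ^+ i.
  by rewrite expr0 -scalerAl mul1r scalerA.
rewrite /mon scaleM malgMUU (mulr1 (1 : K)) //.
Qed.

Lemma mon1 : mon sigma (mone, 0%N) = 1.
Proof. by rewrite /mon /= scale1r. Qed.

Variables (prec : rel Smon) (precP : monomial_order sigma prec).

Lemma prec_mulP (a : Pmon) v w :
  prec v w -> prec (mmul a v.1, v.2) (mmul a w.1, w.2).
Proof.
by move/(prec_mul precP (p := (a, 0%N)) (q := (mone, 0%N))); apply;
  rewrite mon1 mulr1 monM.
Qed.

Definition preceq v w := (v == w) || prec v w.

Lemma preceq_total v w : preceq v w || preceq w v.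
Proof.
have [->|/(prec_total precP)] := eqVneq v w; first by rewrite /preceq eqxx.
by rewrite /preceq; case/orP => ->; rewrite !orbT.
Qed.

Lemma preceq_trans v w x : preceq v w -> preceq w x -> preceq v x.
Proof.
move=> /predU1P[->//|vw] /predU1P[<-|wx]; rewrite /preceq ?vw ?orbT //.
by rewrite (prec_trans precP vw wx) orbT.
Qed.

Lemma preceq_anti v w : preceq v w -> preceq w v -> v = w.
Proof.
move=> /predU1P[->//|vw] /predU1P[->//|wv].
by have := prec_trans precP vw wv; rewrite (prec_irr precP).
Qed.

Lemma foldr_max_ub v0 (l : seq Smon) v :
  v \in v0 :: l -> preceq v (foldr (fun v w => if prec w v then v else w) v0 l).
Proof.
elim: l => [|w l IH] /=; first by rewrite inE /preceq => ->.
rewrite !in_cons orbCA -in_cons; case: ifP => [lt_w|nlt_w].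
  case/predU1P => [->|/IH le_v]; first by rewrite /preceq eqxx.
  by apply: preceq_trans le_v _; rewrite /preceq lt_w orbT.
case/predU1P => [->|/IH //].
by case/orP: (preceq_total w (foldr (fun v w => if prec w v then v else w) v0 l))
  => // /predU1P[<-|]; rewrite /preceq ?eqxx ?nlt_w.
Qed.

Lemma foldr_max_mem v0 (l : seq Smon) :
  foldr (fun v w => if prec w v then v else w) v0 l \in v0 :: l.
Proof.
elim: l => [|w l IH] /=; first exact: mem_head.
by rewrite !in_cons orbCA -in_cons; case: ifP => _; rewrite ?eqxx ?IH ?orbT.
Qed.

Notation lm := (lm prec).
Notation lc := (lc prec).

Lemma lm_ub f v : v \in monos f -> preceq v (lm f).
Proof. by move=> vf; apply: foldr_max_ub; rewrite in_cons vf orbT. Qed.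

Lemma lm_mem f : f <> 0 -> lm f \in monos f.
Proof.
move=> nz_f; have := foldr_max_mem (head (mone, 0%N) (monos f)) (monos f).
rewrite -/(lm f) in_cons; case/predU1P=> [->|//].
case: (monos f) (@monos_eq0 f) => [f0|? ? _]; last exact: mem_head.
by case: nz_f; exact: f0.
Qed.

Lemma lm0 : lm (0 : S) = (mone, 0%N).
Proof.
rewrite /Defs.lm; suff -> : monos (0 : S) = [::] by [].
case def_l : (monos (0 : S)) => [//|v l]; have := mem_head v l.
by rewrite -def_l mem_monos coef_skew0 mcoeff0 eqxx.
Qed.

Lemma lm_unique f v :
  v \in monos f -> (forall w, w \in monos f -> preceq w v) -> lm f = v.
Proof.
move=> vf v_ub; apply: preceq_anti (lm_ub vf); apply/v_ub/lm_mem => f0.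
by move: vf; rewrite f0 mem_monos coef_skew0 mcoeff0 eqxx.
Qed.

Lemma lc_neq0 f : f <> 0 -> lc f != 0.
Proof. by move/lm_mem; rewrite mem_monos. Qed.

(** In a graded ideal this allows an arbitrary element to be replaced by a homogeneous one with the
    same leading monomial. *)
Lemma lm_component f : f <> 0 ->
  let g := f`_(lm f).2 *: s ^+ (lm f).2 in g <> 0 /\ lm g = lm f.
Proof.
move=> /lm_mem lm_f g.
have mem_g v : (v \in monos g) = (v.2 == (lm f).2) && (v \in monos f).
  rewrite !mem_monos coef_skewZX; case: (v.2 =P _) => [->//|_].
  by rewrite mcoeff0 eqxx.
have lm_g : lm f \in monos g by rewrite mem_g eqxx.
split; last first.
  by apply: lm_unique => // w; rewrite mem_g => /andP[_ /lm_ub].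
by move=> g0; move: lm_g; rewrite g0 mem_monos coef_skew0 mcoeff0 eqxx.
Qed.

Lemma lm_homog p i : p <> 0 -> (lm (p *: s ^+ i)).2 = i.
Proof.
move=> nz_p; have: lm (p *: s ^+ i) \in monos (p *: s ^+ i).
  apply: lm_mem => ps0; apply: nz_p.
  by have := coef_skewZX p i i; rewrite ps0 coef_skew0 eqxx.
by rewrite mem_monos coef_skewZX; case: (_ =P i) => // _; rewrite mcoeff0 eqxx.
Qed.

Lemma sdeg_homog p i : p <> 0 -> sdeg (p *: s ^+ i) = i.
Proof.
move=> /eqP nz_p; rewrite /sdeg skew_sX.
have -> : size (p *: Skew sigma 'X^i) = size (p%:P * 'X^i) by rewrite mul_polyC.
by rewrite size_mulXn ?polyC_eq0 // size_polyC nz_p addn1.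
Qed.

(** All monomials of the subtracted multiple of g are at most a lm(g) = lm(h), by compatibility of
    the order with products, and the coefficients at lm(h) cancel. *)
Lemma reduce1_lm (G : set S) h h' : reduce1 prec G h h' ->
  h' <> 0 -> prec (lm h') (lm h).
Proof.
case=> nz_h [g [a [_ nz_g]]]; rewrite monM => /mon_inj lm_h ->.
set c := lc h / lc g => nz_h'.
have := lm_mem nz_h'; set v := lm _ => v_h'.
have : v = lm h \/ prec v (lm h).
  apply/predU1P; move: v_h'.
  rewrite mem_monos coef_skewD coef_skewN mcoeffB coef_skewZ => nz_v.
  have [/lm_ub //|] := boolP (v \in monos h).
  rewrite mem_monos negbK => /eqP h_v; move: nz_v; rewrite h_v sub0r oppr_eq0.
  rewrite mcoeff_neq0 => /msuppM_le[m1 [m2 [/(fsubsetP msuppU_le)/fset1P-> m2g v1]]].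
  have : preceq (m2, v.2) (lm g) by rewrite lm_ub // mem_monos mcoeff_neq0.
  case/predU1P => [def_m2|/(prec_mulP a)]; last first.
    by rewrite /= -v1 -lm_h -surjective_pairing /preceq => ->; rewrite orbT.
  by rewrite lm_h -def_m2 /= -v1 -surjective_pairing /preceq eqxx.
(* Equality is excluded: the coefficient of [h'] at lm(h) is lc(h) - (lc(h)/lc(g)) lc(g) = 0. *)
case=> // v_lm; move: v_h'; rewrite v_lm mem_monos.
rewrite coef_skewD coef_skewN mcoeffB coef_skewZ.
rewrite {3 4}lm_h /= mcoeff_mulU -/(lc g) divfK ?lc_neq0 //.
by rewrite -/(lc h) subrr eqxx.
Qed.

End SkewMonomials.

(** * Homogeneous elements over K[W_e] *)

Section Span.
Variable K : fieldType.
Implicit Types (T : set (Ppoly K)) (p q t : Ppoly K).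

(** The ideal of P generated by T, built with term multipliers so that an induction meets a single
    monomial factor at a time. *)
Inductive span T : Ppoly K -> Prop :=
| span0 : span T 0
| span_cons c (m : Pmon) t p :
    T t -> span T p -> span T (<< c *g m >> * t + p).

Lemma spanD T p q : span T p -> span T q -> span T (p + q).
Proof.
move=> Tp Tq; elim: Tp => [|c m t {}p Tt _ IH]; first by rewrite add0r.
by rewrite -addrA; exact: span_cons.
Qed.

Lemma span_gen T t : T t -> span T t.
Proof.
move=> Tt; rewrite -[t]addr0 -[t in t + 0]mul1r.
exact: (span_cons 1 mone Tt (span0 T)).
Qed.

Lemma spanM T p q : span T p -> span T (q * p).
Proof.
move=> Tp; rewrite [q]monalgE big_distrl /=.
apply: (big_ind (span T) (span0 T) (@spanD T)) => m _.
elim: Tp => [|c n t {}p Tt _ IH]; first by rewrite mulr0; exact: span0.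
by rewrite mulrDr mulrA malgMUU; exact: span_cons.
Qed.

(* Collecting the terms with a fixed part [m] outside [W] maps the extension
   of an ideal of K[W] back to that ideal. *)
Lemma span_project (W : {fset nat}) T p (m : Pmon) :
    T 0 -> (forall t u, T t -> T u -> T (t + u)) ->
    (forall q t, poly_in W q -> T t -> T (q * t)) ->
    (forall t, T t -> poly_in W t) ->
    (forall k, k \in W -> m k = 0%N) -> span T p ->
  exists2 t, T t & forall n, mon_in W n -> t@_n = p@_(mmul m n).
Proof.
move=> T0 TD TM TW mW; elim=> [|c k t {}p Tt _ [t' Tt' t'E]].
  by exists 0 => // n _; rewrite !mcoeff0.
have [k1 [k2 [def_k k2W k1W]]] := mon_split W k.
have [def_k1|neq_k1] := eqVneq k1 m.
  exists (<< c *g k2 >> * t + t') => [|n nW].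
    by apply: TD Tt'; apply: TM Tt; exact: poly_inU.
  have := mcoeff_mulUM c k2 m n t; rewrite -def_k1 -def_k def_k1 => eq_t.
  by rewrite (mcoeffD _ _ t') (mcoeffD _ _ p) eq_t t'E.
(* Every monomial of k t has outside part [k1], which differs from m, so this summand contributes
   nothing at m n. *)
exists t' => // n nW; rewrite t'E // mcoeffD.
suff /mcoeff_outdom-> : mmul m n \notin msupp (<< c *g k >> * t) by rewrite add0r.
apply/negP => /msuppM_le[_ [u [/(fsubsetP msuppU_le)/fset1P -> /(TW _ Tt) uW]]].
move=> eq_mn; case/eqP: neq_k1; apply: cmonomP => i.
have [iW|iW] := boolP (i \in W); first by rewrite k1W ?mW.
move/(congr1 (fun v : Pmon => v i)): eq_mn.
by rewrite def_k !cmM nW ?k2W ?uW // !addn0.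
Qed.

End Span.

(** * Graded components with coefficients in K[W_e] *)

Section Homogeneous.
Variables (K : fieldType) (sigma : {lrmorphism Ppoly K -> Ppoly K}).
Variable W : {fset nat}.

Notation S := (skewpoly sigma).
Notation s := (skew_s sigma).

Implicit Types (f g h : S) (p q : Ppoly K) (v w : Smon).

Definition graded_vars e := iter e (sigma_vars sigma) W.

Lemma graded_vars_le i j : (i <= j)%N -> (graded_vars i `<=` graded_vars j)%fset.
Proof.
move/subnK => <-; elim: (j - i)%N => [|k IH]; first exact: fsubset_refl.
exact: fsubset_trans IH (fsubsetUl _ _).
Qed.

Lemma poly_in_iter i e p : poly_in (graded_vars e) p ->
  poly_in (graded_vars (i + e)) (iter i sigma p).
Proof. by move=> pW; elim: i => //= i; exact: poly_in_sigma. Qed.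

(** Zero qualifies for every e, so statements about degrees and leading monomials ask for f
    nonzero. *)
Definition homog_in e f := exists2 p, poly_in (graded_vars e) p & f = p *: s ^+ e.

Lemma homog_inB e f g : homog_in e f -> homog_in e g -> homog_in e (f - g).
Proof.
move=> [p pW ->] [q qW ->]; exists (p - q); last by rewrite scalerBl.
exact/(poly_inD pW)/poly_inN.
Qed.

Lemma homog_inZ e q f :
  poly_in (graded_vars e) q -> homog_in e f -> homog_in e (q *: f).
Proof.
by move=> qW [p pW ->]; exists (q * p); [exact: poly_inM|rewrite scalerA].
Qed.

(** Left multiplication by s^i applies sigma^i to the coefficient and raises the degree by i,
    matching the growth of the variable sets; right multiplication by s^j only raises the degree. *)
Lemma homog_in_shift i j e f :
  homog_in e f -> homog_in (i + e + j) (s ^+ i * f * s ^+ j).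
Proof.
move=> [p pW ->]; exists (iter i sigma p); last exact: skew_shift.
apply: poly_inW (graded_vars_le (leq_addr _ _)) _.
exact: poly_in_iter pW.
Qed.

Lemma homog_in_sdeg e f : homog_in e f -> f <> 0 -> sdeg f = e.
Proof.
by move=> [p _ ->] nz; apply: sdeg_homog => p0; apply: nz; rewrite p0 scale0r.
Qed.

Variables (prec : rel Smon) (precP : monomial_order sigma prec).

Lemma homog_in_lm e f : homog_in e f -> f <> 0 ->
  (lm prec f).2 = e /\ mon_in (graded_vars e) (lm prec f).1.
Proof.
move=> [p pW ->] nz; have lm2 : (lm prec (p *: s ^+ e)).2 = e.
  by apply: lm_homog => p0; apply: nz; rewrite p0 scale0r.
split=> //; apply: pW; rewrite -mcoeff_neq0.
by have := lm_mem prec nz; rewrite mem_monos lm2 coef_skewZX eqxx.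
Qed.

Lemma homog_in_spoly e f g :
  homog_in e f -> homog_in e g -> homog_in e (spoly prec f g).
Proof.
have lmW h : homog_in e h -> mon_in (graded_vars e) (lm prec h).1.
  move=> hW; have [h0|nz_h] := pselect (h = 0); last by have [] := homog_in_lm hW nz_h.
  by rewrite h0 lm0; exact: mon_in1.
move=> fW gW; apply: homog_inB; apply: homog_inZ => //.
  by apply/poly_inU/mon_in_divcm/mon_in_mlcm; apply: lmW.
by apply/poly_inU/mon_in_divcm/mon_in_mlcm; apply: lmW.
Qed.

(** For a two-sided ideal J this is an ideal of K[W_e]: the part of J_e with coefficients in these
    variables. *)
Definition coef_ideal (J : set S) e : set (Ppoly K) :=
  [set t | poly_in (graded_vars e) t /\ J (t *: s ^+ e)].

Lemma ideal_scale (J : set S) p f : two_sided_ideal J -> J f -> J (p *: f).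
Proof.
by move=> [_ _ JM] /(JM p%:A _ 1); rewrite mulr1 -scalerAl mul1r.
Qed.

Lemma ideal_coef_span (J H : set S) d : two_sided_ideal J ->
    ideal_gen H = J -> nz_homogeneous H ->
    (forall f, trunc d H f -> homog_in (sdeg f) f) ->
  forall f e, J f -> (e <= d)%N -> span (coef_ideal J e) f`_e.
Proof.
move=> J_ideal HJ H_homog H_in f e; rewrite -{1}HJ.
(* It suffices that [I] is a two-sided ideal containing H. *)
pose I : set S := [set f | forall e, (e <= d)%N -> span (coef_ideal J e) f`_e].
move/(_ I); apply.
have JH g : H g -> J g by rewrite -HJ => Hg I' [_]; apply.
split; [split|].
- by move=> i _; rewrite coef_skew0; exact: span0.
- by move=> g h Ig Ih i le_id; rewrite coef_skewD; apply: spanD; [exact: Ig|exact: Ih].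
- move=> a g b Ig k le_kd; rewrite coef_skewM.
  apply: (big_ind (span _) (span0 _) (@spanD _ _)) => j _.
  have le_jk : (j <= k)%N by rewrite -ltnS.
  rewrite coef_skewM big_distrl /=.
  apply: (big_ind (span _) (span0 _) (@spanD _ _)) => i _.
  have le_ij : (i <= j)%N by rewrite -ltnS.
  (* Commutativity of P moves the factor coming from b to the left, leaving sigma^i of a coefficient
     of g. On a generator t this is the coefficient of s^i (t s^(j-i)) s^(k-j), an element of J. *)
  rewrite mulrAC; apply: spanM.
  have := Ig (j - i)%N; set q := g`_ _.
  have le_jid : (j - i <= d)%N.
    exact: leq_trans (leq_subr _ _) (leq_trans le_jk le_kd).
  move/(_ le_jid); elim=> [|c m t p [tW Jt] _ IH].
    by rewrite iter_sigma0; exact: span0.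
  rewrite iter_additive iter_multiplicative.
  apply: spanD IH; apply/spanM/span_gen; split.
    apply: poly_inW (@poly_in_iter i _ _ tW).
    by apply: graded_vars_le; rewrite subnKC.
  have [_ _ JM] := J_ideal; have := JM (s ^+ i) _ (s ^+ (k - j)) Jt.
  by rewrite skew_shift !subnKC.
- move=> g Hg i le_id; have [nz_g [j [p def_g]]] := H_homog g Hg.
  have nz_p : p <> 0 by move=> p0; apply: nz_g; rewrite def_g p0 scale0r.
  rewrite def_g coef_skewZX; case: (i =P j) => [eq_ij|_]; last exact: span0.
  have deg_g : sdeg g = j by rewrite def_g; exact: sdeg_homog.
  have [|q qW eq_g] := H_in g; first by split=> //; rewrite deg_g -eq_ij.
  have <- : q = p.
    have := congr1 (fun h : S => h`_j) eq_g.
    by rewrite deg_g {1}def_g /= !coef_skewZX eqxx.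
  apply: span_gen; split; first by rewrite eq_ij -deg_g.
  by rewrite eq_ij -deg_g -eq_g; exact: JH.
Qed.

(** Write the P-part of lm(f) as m n with n in the variables W_e and m free of them. Projecting the
    coefficient of f onto its terms with outside part m gives an element of J with leading monomial
    n s^e. *)
Lemma ideal_lm_dvd (J : set S) e f : two_sided_ideal J ->
    f <> 0 -> span (coef_ideal J e) f`_e -> (lm prec f).2 = e ->
  exists g, [/\ J g, g <> 0, homog_in e g & smon_dvd (lm prec g) (lm prec f)].
Proof.
move=> J_ideal nz_f Tf def_e.
have [m [n [def_mn nW mW]]] := mon_split (graded_vars e) (lm prec f).1.
have [||||t [tW Jt] tE] := span_project _ _ _ _ mW Tf.
- by split; [exact: poly_in0|rewrite scale0r; case: J_ideal].
- move=> t u [tW Jt] [uW Ju]; split; first exact: poly_inD.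
  by rewrite scalerDl; case: J_ideal => _ JD _; exact: JD.
- move=> q t qW [tW Jt]; split; first exact: poly_inM.
  by rewrite -scalerA; exact: ideal_scale.
- by move=> t [].
have lm_f := lm_mem prec nz_f; rewrite mem_monos def_e def_mn -tE // in lm_f.
have n_g : (n, e) \in monos (t *: s ^+ e : S) by rewrite mem_monos coef_skewZX eqxx.
exists (t *: s ^+ e); split=> //.
- by move=> g0; move: n_g; rewrite g0 mem_monos coef_skew0 mcoeff0 eqxx.
- by exists t.
rewrite (lm_unique precP (v := (n, e))) //.
  by apply/smon_dvdP; exists m; rewrite /= -def_mn -def_e -surjective_pairing.
move=> [k i]; rewrite mem_monos coef_skewZX /=; case: (i =P e) => [->|_]; last first.
  by rewrite mcoeff0 eqxx.
rewrite mcoeff_neq0 => kt; have kW := tW _ kt.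
move: kt; rewrite -mcoeff_neq0 tE // => mk.
(* A monomial k of t yields the monomial m k s^e of f, hence m k s^e is at most lm(f) = m n s^e; the
   factor m is then cancelled. *)
have : preceq prec (mmul m k, e) (mmul m n, e).
  rewrite -{2}def_e -def_mn -surjective_pairing; apply: lm_ub => //.
  by rewrite mem_monos.
have [|/predU1P[->|]] := orP (preceq_total precP (k, e) (n, e)) => //.
  by rewrite /preceq eqxx.
move=> /(prec_mulP precP m)/= lt_nk le_kn; move: (preceq_anti precP le_kn).
rewrite /preceq lt_nk orbT => /(_ isT) [/mmul_inj->].
by rewrite eqxx.
Qed.

End Homogeneous.

(** * Truncated Groebner bases and termination *)

Section IdealGen.
Variables (K : fieldType) (sigma : {lrmorphism Ppoly K -> Ppoly K}).
Implicit Types A B : set (skewpoly sigma).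

Lemma ideal_gen_ideal A : two_sided_ideal (ideal_gen A).
Proof.
split=> [I [[I0 _ _] _] //|f g Af Ag I IA|a f b Af I IA].
  by have [[_ ID _] _] := IA; apply: ID; [exact: Af|exact: Ag].
by have [[_ _ IM] _] := IA; apply: IM; exact: Af.
Qed.

Lemma sub_ideal_gen A : A `<=` ideal_gen A.
Proof. by move=> f Af I [_]; exact. Qed.

Lemma ideal_gen_min A B : A `<=` ideal_gen B -> ideal_gen A `<=` ideal_gen B.
Proof. by move=> AB f; apply; split=> //; exact: ideal_gen_ideal. Qed.

End IdealGen.

(** * Gröbner bases with finite truncation *)

Section Grobner.
Variables (K : fieldType) (sigma : {lrmorphism Ppoly K -> Ppoly K}).
Variables (prec : rel Smon) (precP : monomial_order sigma prec).

Notation S := (skewpoly sigma).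
Notation s := (skew_s sigma).

Implicit Types (f g h u v : S) (w : Smon) (G H J : set S).

Lemma homogeneous_sdeg f : homogeneous f -> f <> 0 ->
  exists2 p, p <> 0 & f = p *: s ^+ sdeg f.
Proof.
move=> [i [p ->]] nz; have nz_p : p <> 0 by move=> p0; apply: nz; rewrite p0 scale0r.
by exists p; rewrite ?sdeg_homog.
Qed.

Lemma common_vars H d : finite_set (trunc d H) -> nz_homogeneous H ->
  exists W, forall f, trunc d H f -> homog_in W (sdeg f) f.
Proof.
move=> /finite_seqP[l H_l] H_homog.
exists (\bigcup_(f <- l) pvars (f`_(sdeg f)))%fset => f Hf.
have [nz_f /homogeneous_sdeg/(_ nz_f)[p _ def_f]] := H_homog f Hf.1.
exists p => //; apply: poly_inW (graded_vars_le _ _ (leq0n _)) _.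
apply: poly_inW (@poly_in_pvars _ p).
have -> : p = f`_(sdeg f) by rewrite {1}def_f coef_skewZX eqxx.
by apply: bigfcup_sup => //; rewrite H_l in Hf.
Qed.

Lemma finite_truncated_grobner_basis J H d :
    two_sided_ideal J -> graded J -> homogeneous_basis J H ->
    finite_set (trunc d H) ->
  exists G, [/\ nz_homogeneous G, grobner_basis prec J G & finite_set (trunc d G)].
Proof.
move=> J_ideal J_graded [H_homog HJ] H_fin.
have [W H_in] := common_vars H_fin H_homog.
(* Only elements over the finite variable sets enter [A], so that Dickson's lemma applies to their
   leading monomials. *)
pose A g := [/\ J g, g <> 0 & exists2 e, (e <= d)%N & homog_in W e g].
have A_dom g : A g ->
    mon_in (graded_vars sigma W d) (lm prec g).1 /\ ((lm prec g).2 <= d)%N.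
  move=> [_ nz_g [e le_ed gW]]; have [-> gWe] := homog_in_lm prec gW nz_g.
  by split=> //; exact: mon_inW (graded_vars_le _ _ le_ed) gWe.
have [l [lA l_basis]] := wqo_finite_basis (@dickson _ d) A_dom.
pose G := [set g | g \in l \/ [/\ J g, g <> 0, homogeneous g & (d < sdeg g)%N]].
have GJ : G `<=` J by move=> g [/lA[]|[]].
exists G; split.
- move=> g [/lA[_ nz_g [e _ [p _ def_g]]]|[]//].
  by split=> //; exists e, p.
- split=> //; apply/seteqP; split; apply: ideal_gen_min => _ [f [Jf nz_f] <-].
    by apply: sub_ideal_gen; exists f => //; split=> //; exact: GJ.
  have [nz_g lm_g] := lm_component precP nz_f; set g := _ *: _ in nz_g lm_g.
  have Jg : J g by exact: J_graded.
  have [le_gd|lt_dg] := leqP (lm prec f).2 d; last first.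
    apply: sub_ideal_gen; exists g; last by rewrite lm_g.
    split=> //; right; split=> //; first by exists (lm prec f).2, f`_(lm prec f).2.
    rewrite sdeg_homog // => f0; apply: nz_g.
    by rewrite /g f0 scale0r.
  have fT := ideal_coef_span J_ideal HJ H_homog H_in Jf le_gd.
  have [g' [Jg' nz_g' g'W dvd_g']] := ideal_lm_dvd precP J_ideal nz_f fT erefl.
  have [|g1 g1l /smon_dvdP[b def_g']] := l_basis g'.
    by split=> //; exists (lm prec f).2.
  (* Two divisibilities are composed: lm(f) = a lm(g') and lm(g') = b lm(g1) with g1 in the finite
     list. *)
  have /smon_dvdP[a ->] := dvd_g'; rewrite def_g' /= mulmA -monM.
  have [_ _ IM] := ideal_gen_ideal (lm_set prec G).
  rewrite -[X in ideal_gen _ X]mulr1; apply: IM; apply: sub_ideal_gen.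
  exists g1 => //; split; first by left.
  by have [] := lA _ g1l.
- apply: sub_finite_set (finite_seq l) => g [[//|[_ _ _]]].
  by rewrite ltnNge => /negP.
Qed.

(** * Termination of the truncated algorithm *)

Section Termination.
Variables (W : {fset nat}) (d : nat).

Notation bounded_in := (fun f => exists2 e, (e <= d)%N & homog_in W e f).

(** The invariant of the algorithm. The common degree e of a pair keeps its S-polynomial homogeneous
    over K[W_e]; finiteness of the basis ensures that an insertion adds finitely many pairs. *)
Record state_ok (st : state sigma) : Prop := StateOk {
  basis_fin : finite_set (st_basis st);
  basis_ok : forall g, st_basis st g -> g <> 0 /\ bounded_in g;
  pairs_fin : finite_set (st_pairs st);
  pairs_ok : forall q, st_pairs st q ->
    exists2 e, (e <= d)%N & homog_in W e q.1 /\ homog_in W e q.2;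
  current_ok : forall h, st_current st = Some h -> bounded_in h }.

Lemma spairs_fin f g : finite_set (spairs d f g).
Proof.
have box n (A : set (nat * nat)) :
    (forall ij, A ij -> (ij.1 <= n)%N /\ (ij.2 <= n)%N) -> finite_set A.
  move=> A_le; apply: sub_finite_set (finite_seq
    (allpairs pair (iota 0 n.+1) (iota 0 n.+1))) => -[i j] /A_le[le_i le_j].
  by apply/allpairsP; exists (i, j); rewrite !mem_iota.
rewrite finite_setU; split; apply: finite_image.
  apply: (box (sdeg f)) => -[i j] /= [<- _].
  by rewrite -addnA; split; [exact: leq_addr|rewrite addnCA leq_addr].
apply: (box d) => -[i j] /= [eq_ij le_d].
split; apply: leq_trans le_d; first exact: leq_addl.
by rewrite eq_ij leq_addl.
Qed.

Lemma spairs_ok f g q : f <> 0 -> g <> 0 -> bounded_in f -> bounded_in g ->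
  spairs d f g q -> exists2 e, (e <= d)%N & homog_in W e q.1 /\ homog_in W e q.2.
Proof.
move=> nz_f nz_g [ef _ fW] [eg _ gW].
have def_ef := homog_in_sdeg fW nz_f; have def_eg := homog_in_sdeg gW nz_g.
case=> -[[i j] /= []]; rewrite def_ef def_eg => eq_ij le_d <- /=.
  exists ef => //; split=> //; rewrite -eq_ij addnAC.
  exact: homog_in_shift.
exists (ef + i)%N => //; split.
  by have := homog_in_shift 0 i fW; rewrite mul1r.
by have := homog_in_shift j 0 gW; rewrite mulr1 addn0 addnC -eq_ij.
Qed.

Lemma shifts_ok G g : (forall g, G g -> g <> 0 /\ bounded_in g) ->
  shifts G g -> exists e, homog_in W e g.
Proof.
move=> G_ok [g0 /G_ok[_ [e _ gW]] [i [j ->]]].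
by exists (i + e + j)%N; exact: homog_in_shift.
Qed.

(** The shifts used may a priori have any degree, but lm(h) = a lm(g) forces the degree of h and
    puts a in the variables W_e. *)
Lemma reduce1_ok G h h' : (forall g, G g -> g <> 0 /\ bounded_in g) ->
  bounded_in h -> reduce1 prec (shifts G) h h' -> bounded_in h'.
Proof.
move=> G_ok [e le_ed hW] [nz_h [g [a [/(shifts_ok G_ok)[e' gW] nz_g]]]].
rewrite monM => /mon_inj lm_h ->; exists e => //.
have [def_e hWe] := homog_in_lm prec hW nz_h.
have [def_e' _] := homog_in_lm prec gW nz_g.
have eq_e : e' = e by rewrite -def_e -def_e' lm_h.
move: hWe; rewrite lm_h => /mon_inM[aW _].
apply: homog_inB => //; apply: homog_inZ; last by rewrite -eq_e.
exact: poly_inU.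
Qed.

Lemma step_ok st st' : state_ok st -> step prec d st st' -> state_ok st'.
Proof.
move=> + st_st'; case: st st' / st_st' => [G B u v Buv _|G B h h' red|G B|G B h nz_h _]
  [/= G_fin G_ok B_fin B_ok h_ok]; split=> //=.
- exact: finite_setD.
- by move=> q [/B_ok].
- move=> _ [<-]; have [e le_ed [uW vW]] := B_ok _ Buv.
  by exists e => //; exact: homog_in_spoly.
- by move=> _ [<-]; apply: reduce1_ok red => //; exact: h_ok.
- by rewrite finite_setU; split=> //; exact: finite_set1.
- by move=> g [->|/G_ok //]; split=> //; exact: h_ok.
- rewrite finite_setU; split.
    by rewrite finite_setU; split=> //; exact: spairs_fin.
  by apply: bigcup_finite => // k _; rewrite finite_setU; split; exact: spairs_fin.
- have hd := h_ok _ erefl.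
  move=> q [[/B_ok//|]|[k /G_ok[nz_k kd] []]]; exact: spairs_ok.
Qed.

(** Three nested inductions: on the list [l] of leading monomials of inserted elements, on the
    length of a list [b] containing the pending pairs, and on the leading monomial of the current
    polynomial. *)
Lemma step_terminates st : state_ok st ->
  Acc (fun st' st => step prec d st st') st.
Proof.
suff acc (l : seq Smon) : forall G B (h : option S), state_ok (State G B h) ->
    (forall w, w \in l -> exists2 g, G g & lm prec g = w) ->
    Acc (fun st' st => step prec d st st') (State G B h).
  by case: st => G B h ok; apply: (acc [::]).
elim: {l}(wqo_bad_extension_wf (@dickson (graded_vars sigma W d) d) l) => l _ IHl.
(* While the basis does not change, each selection removes a pending pair and
   each reduction lowers the leading monomial. *)
move=> G B h ok lG; have [b Bb] : exists b : seq (S * S), forall q, B q -> q \in b.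
  by have [/= _ _ /finite_seqP[b ->]] := ok; exists b.
have [n] := ubnP (size b).
elim: n => [|n IHn] in B b h ok Bb *.
  by rewrite ltn0.
rewrite ltnS => le_bn.
(* With no current polynomial the only possible step is a selection, which shortens [b]. *)
have select B' : state_ok (State G B' None) -> (forall q, B' q -> q \in b) ->
    Acc (fun st' st => step prec d st st') (State G B' None).
  move=> ok' B'b; constructor=> st' st_st'; have := step_ok ok' st_st'.
  inversion st_st' as [? ? u v B'uv _| | |] => ok1; subst.
  apply: (IHn _ (rem (u, v) b)) => //.
    move=> q [B'q /= /eqP neq_q]; move: (B'b q B'q).
    by rewrite (perm_mem (perm_to_rem (B'b _ B'uv))) in_cons (negbTE neq_q).
  by rewrite size_rem ?B'b //; case: (b) le_bn (B'b _ B'uv).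
case: h ok => [h|] ok; last exact: select.
have [w] : exists w, w = lm prec h by exists (lm prec h).
elim: {w}(prec_wf precP w) h ok => w _ IHw h ok def_w.
constructor=> st' st_st'; have ok' := step_ok ok st_st'.
inversion st_st' as [|? ? ? h' red| |? ? ? nz_h irred]; subst.
(* The leading monomial of 0 is only a default, so the descent on leading monomials does not cover
   0; from 0 the only step is to discard it. *)
- have [h'0|nz_h'] := pselect (h' = 0).
    rewrite h'0 in ok' *; constructor=> st2 st_st2; have ok2 := step_ok ok' st_st2.
    inversion st_st2 as [|? ? ? ? [nz _]|?|? ? ? nz]; subst; [by []| |by []].
    exact: select.
  by apply: IHw ok' erefl; exact: reduce1_lm red nz_h'.
- exact: select.
- apply: (IHl (lm prec h :: l)) => //; last first.
    move=> w /predU1P[->|/lG[g Gg <-]]; first by exists h => //; left.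
    by exists g => //; right.
  have [_ G_ok _ _ /(_ h erefl)[e le_ed hW]] := ok.
  have [def_e hWe] := homog_in_lm prec hW nz_h.
  constructor.
    by rewrite def_e; split=> //; exact: mon_inW (graded_vars_le _ _ le_ed) hWe.
  (* If lm(g) divided lm(h) for some g in the basis, then g, as its own shift with i = j = 0, would
     still reduce h. *)
  move=> w /lG[g Gg <-] /smon_dvdP[a lm_h]; apply: irred.
  exists (h - << lc prec h / lc prec g *g a >> *: g); split=> //.
  exists g, a; split=> //; last by rewrite monM -lm_h.
    by exists g => //; exists 0%N, 0%N; rewrite mul1r mulr1.
  by have [] := G_ok g Gg.
Qed.

End Termination.

End Grobner.

Theorem proposition4p7 (K : fieldType)
    (sigma : {lrmorphism Ppoly K -> Ppoly K})
    (sigma_inj : injective sigma)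
    (sigma_inf : infinite_order sigma)
    (sigma_mon : monomial_preserving sigma)
    (sigma_gcd : forall i j : nat, i != j ->
       gcd_one (sigma (x_ K i)) (sigma (x_ K j)))
    (prec : rel Smon) (precP : monomial_order sigma prec)
    (J : set (skewpoly sigma))
    (J_ideal : two_sided_ideal J) (J_graded : graded J)
    (d : nat) (H : set (skewpoly sigma))
    (H_basis : homogeneous_basis J H)
    (H_fin : finite_set (trunc d H)) :
  (exists G : set (skewpoly sigma),
     [/\ nz_homogeneous G, grobner_basis prec J G & finite_set (trunc d G)])
  /\ truncated_SkewGBasis_terminates prec d H.
Proof.
split; first exact: finite_truncated_grobner_basis J_ideal J_graded H_basis H_fin.
have [H_homog _] := H_basis; have [W H_in] := common_vars H_fin H_homog.
apply: (step_terminates precP (W := W)).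
have H_ok f : trunc d H f -> f <> 0 /\ exists2 e, (e <= d)%N & homog_in W e f.
  move=> Hf; split; first by have [] := H_homog f Hf.1.
  by exists (sdeg f); [exact: Hf.2|exact: H_in].
split=> //=.
  by apply: bigcup_finite => // f _; apply: bigcup_finite => // g _; exact: spairs_fin.
move=> q [f /H_ok[nz_f fd] [g /H_ok[nz_g gd]]]; exact: spairs_ok.
Qed.
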